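(* Let $D\in\mathbb{C}$ be arbitrary and let $P_m,Q_m,R_m$ be the polynomials defined in the context. Then the degrees of $P_{m+1}$, $Q_m$ and $R_m$ are at most $\left\lfloor\frac{m+2}{2}\right\rfloor$ for $m=0,1,2,\ldots$
   Context: Fix $D\in\mathbb{C}$. Polynomials $P_m$ ($m\ge -1$), $Q_m$, $R_m$ ($m\ge -2$) in one variable $u$ (standing for $u=\eta+C$ with $C$ a constant, so that degree in $u$ equals degree in $\eta$) are defined as follows. Initial values: $Q_{-2}=-\frac{i}{5}$, $R_{-2}=-\frac15$; $P_{-1}=2i$, $Q_{-1}=2i$, $R_{-1}=\frac{17}{9}$; $P_0=\frac{71}{9}i$, $Q_0=-\frac{349}{81}i-\frac{988}{81}iu$, $R_0=\frac{1385}{54}-\frac{988}{81}u$; $P_1=-\frac{9880}{81}iu$, $Q_1=-\frac{25991}{108}i+\frac{64220}{243}iu$, $R_1=-\frac{211189}{972}+\frac{167960}{729}u$; $P_2=-\frac{2108195}{972}i+\frac{469300}{243}iu$, $Q_2=\frac{3}{10}iD-\frac{477319147}{131220}i-\frac{167831753}{65610}iu-\frac{273676}{2187}iu^2$, $R_2=-\frac15D+\frac{138959125}{17496}-\frac{58846039}{32805}u-\frac{1444456}{2187}u^2$; $P_3=iD-\frac{96356411}{6561}iu-\frac{2736760}{6561}iu^2$. For $m\ge 3$, the triple $X_m=(P_{m+1},Q_m,R_m)^T$ is defined recursively as the unique polynomial solution of $$\frac{dX_m}{du}=A_mX_m+F_m,$$ where $$A_m=\begin{pmatrix}-m-1&10&0\\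 \frac15&-m&-2i\\ -\frac i5&2i&-m\end{pmatrix},\qquad F_m=\begin{pmatrix}-10P_m\\ 28P_{m-1}-Q_{m-1}-\sum_{j=0}^mP_jR_{m-j-1}\\ -\frac83R_{m-1}+\sum_{j=0}^mP_jQ_{m-j-1}\end{pmatrix}.$$ ($A_m$ has eigenvalues $-m+2,-m,-m-3$, so it is invertible for $m\ge3$ and the polynomial solution is unique.) *)

(* Defs.v *)
From Stdlib Require Import BinNat.
From mathcomp Require Import all_boot all_order all_algebra.
From mathcomp Require Import reals complex.

Set Implicit Arguments.
Unset Strict Implicit.
Unset Printing Implicit Defensive.

Import Order.TTheory GRing.Theory Num.Theory.
Local Open Scope ring_scope.
Local Open Scope complex_scope.

(* The fraction p / q.  Numerator and denominator are binary numbers because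
   ring_scope literals of the size needed below would be unary. *)
Definition frac (K : realType) (p q : N) : K[i] :=
  (nat_of_bin p)%:R / (nat_of_bin q)%:R.
Arguments frac {K} (p q)%_N_scope : simpl never.

Section Expansion.
Variable K : realType.
Local Notation C := K[i].
Implicit Types (D : C) (P Q R : int -> {poly C}) (m : nat).

Definition mx3 (s : seq (seq C)) : 'M[C]_3 :=
  \matrix_(i < 3, j < 3) nth 0 (nth [::] s i) j.

Definition col3 (a b c : {poly C}) : 'cV[{poly C}]_3 :=
  \col_(i < 3) nth 0 [:: a; b; c] i.

Definition matA m : 'M[C]_3 := mx3
  [:: [:: - m%:R - 1;      10;     0      ];
      [:: frac 1 5;        - m%:R; - 2 * 'i];
      [:: - frac 1 5 * 'i; 2 * 'i; - m%:R  ]].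

Definition vecX P Q R m : 'cV[{poly C}]_3 :=
  col3 (P (m%:Z + 1)) (Q m%:Z) (R m%:Z).

Definition vecF P Q R m : 'cV[{poly C}]_3 := col3
  (- 10 *: P m%:Z)
  (28 *: P (m%:Z - 1) - Q (m%:Z - 1)
     - \sum_(j < m.+1) P j%:Z * R (m%:Z - j%:Z - 1))
  (- frac 8 3 *: R (m%:Z - 1)
     + \sum_(j < m.+1) P j%:Z * Q (m%:Z - j%:Z - 1)).

(* The families are indexed by int because indices start at -1 (for P) and
   -2 (for Q, R); values at smaller indices are unconstrained and never used.
   The indeterminate 'X is the variable u. *)
Record expansion D P Q R : Prop := Expansion {
  exp_Qm2 : Q (-2)%Z = (- frac 1 5 * 'i)%:P;
  exp_Rm2 : R (-2)%Z = (- frac 1 5)%:P;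

  exp_Pm1 : P (-1)%Z = (2 * 'i)%:P;
  exp_Qm1 : Q (-1)%Z = (2 * 'i)%:P;
  exp_Rm1 : R (-1)%Z = (frac 17 9)%:P;

  exp_P0 : P 0%Z = (frac 71 9 * 'i)%:P;
  exp_Q0 : Q 0%Z = (- frac 349 81 * 'i)%:P - (frac 988 81 * 'i) *: 'X;
  exp_R0 : R 0%Z = (frac 1385 54)%:P - frac 988 81 *: 'X;

  exp_P1 : P 1%Z = - (frac 9880 81 * 'i) *: 'X;
  exp_Q1 : Q 1%Z =
    (- frac 25991 108 * 'i)%:P + (frac 64220 243 * 'i) *: 'X;
  exp_R1 : R 1%Z = (- frac 211189 972)%:P + frac 167960 729 *: 'X;

  exp_P2 : P 2%Z =
    (- frac 2108195 972 * 'i)%:P + (frac 469300 243 * 'i) *: 'X;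
  exp_Q2 : Q 2%Z =
    (frac 3 10 * 'i * D - frac 477319147 131220 * 'i)%:P
    - (frac 167831753 65610 * 'i) *: 'X
    - (frac 273676 2187 * 'i) *: 'X^2;
  exp_R2 : R 2%Z =
    (- frac 1 5 * D + frac 138959125 17496)%:P
    - frac 58846039 32805 *: 'X
    - frac 1444456 2187 *: 'X^2;

  exp_P3 : P 3%Z =
    ('i * D)%:P - (frac 96356411 6561 * 'i) *: 'X
    - (frac 2736760 6561 * 'i) *: 'X^2;

  exp_ode : forall m, (3 <= m)%N ->
    map_mx (@deriv C) (vecX P Q R m)
      = map_mx (@polyC C) (matA m) *m vecX P Q R m + vecF P Q R m
}.

End Expansion.

(* Main.v *)
(* The matrix A_m is injective for m >= 3, so a polynomial solution of
   X' = A_m X + F_m has degree at most deg F_m: the top coefficient of a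
   solution of larger degree would lie in the kernel of A_m.  Writing S_n for
   the largest degree in (P_n, Q_(n-1), R_(n-1)), the bound S_n <= (n+1)/2
   propagates because floor((j+1)/2) + floor((m-j+1)/2) <= floor((m+2)/2). *)
Require Import Defs.
From mathcomp Require Import all_boot all_order all_algebra.
From mathcomp Require Import reals complex.
From mathcomp Require Import zify ring.
Import Order.TTheory GRing.Theory Num.Theory.
Local Open Scope ring_scope.

(** On coefficients of u^k the equation reads A x_k = (k+1) x_(k+1) - f_k, and f_k = 0 for k >= d.
    Hence x_(k+1) = 0 forces x_k = 0, and vanishing descends from beyond the degree of [X] down to
    d. *)
Lemma size_linear_ode_sol (C : comNzRingType) (n d : nat) (A : 'M[C]_n)
    (X F : 'cV[{poly C}]_n) :
  (forall x : 'cV[C]_n, A *m x = 0 -> x = 0) ->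
  (forall i, (size (F i 0%R) <= d)%N) ->
  map_mx (@deriv C) X = map_mx (@polyC C) A *m X + F ->
  forall i, (size (X i 0%R) <= d)%N.
Proof.
move=> injA szF odeX.
have coefX k : A *m map_mx (coefp k) X =
    map_mx (coefp k.+1) X *+ k.+1 - map_mx (coefp k) F.
  apply/matrixP=> i j; move/matrixP: odeX => /(_ i j).
  rewrite !mxE => /(congr1 (coefp k)); rewrite /= coef_deriv coefD => E.
  rewrite mulmxnE !mxE /= E addrK coef_sum; apply: eq_bigr => l _.
  by rewrite !mxE coefCM.
pose N := \max_i size (X i 0%R).
(* Downward induction on k, run upwards on the slack t; taking t = N later makes the second
   hypothesis automatic. *)
have X0 t k : (d <= k)%N -> (N <= k + t)%N -> map_mx (coefp k) X = 0.
  elim: t k => [|t IH] k dk Nk.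
    apply/matrixP=> i j; rewrite !mxE /= nth_default // ord1.
    rewrite addn0 in Nk; apply: leq_trans Nk.
    exact: (leq_bigmax (F := fun i => size (X i 0%R))).
  apply: injA; rewrite coefX IH ?addSnnS ?leqW // mul0rn sub0r.
  apply/matrixP=> i j; rewrite !mxE /= ord1 nth_default ?oppr0 //.
  exact: leq_trans (szF i) dk.
move=> i; apply/leq_sizeP => k dk.
by have /matrixP/(_ i 0) := X0 N k dk (leq_addl _ _); rewrite !mxE.
Qed.

Lemma size_polyD_le (C : nzRingType) (p q : {poly C}) (d : nat) :
  (size p <= d)%N -> (size q <= d)%N -> (size (p + q)%R <= d)%N.
Proof. by move=> pd qd; rewrite (leq_trans (size_polyD _ _)) // geq_max pd. Qed.

Lemma size_scale_le (C : nzRingType) (k : C) (p : {poly C}) (d : nat) :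
  (size p <= d)%N -> (size (k *: p)%R <= d)%N.
Proof. exact: leq_trans (size_scale_leq _ _). Qed.

Lemma mulmx_matA_eq0 (K : realType) (m : nat) (x : 'cV[K[i]]_3) :
  (3 <= m)%N -> matA K m *m x = 0 -> x = 0.
Proof.
move=> m3 /matrixP Ax0.
pose o0 : 'I_3 := 0; pose o1 : 'I_3 := lift 0 0.
pose o2 : 'I_3 := lift 0 (lift 0 0).
have := Ax0 o0 0; have := Ax0 o1 0; have := Ax0 o2 0.
rewrite !mxE !big_ord_recl !big_ord0 !mxE /=.
rewrite -/o0 -/o1 -/o2 !addr0 mul0r addr0.
have i2 : 'i%C * 'i%C = -1 :> K[i] by rewrite -expr2 sqr_i.
have nz (n : nat) : n.+1%:R != 0 :> K[i] by rewrite pnatr_eq0.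
set f := Defs.frac _ _.
have f5 : f * 5 = 1 by rewrite /f /Defs.frac /= mul1r mulVf ?nz.
case: m m3 {Ax0} => [|[|[|m]]] // _.
move Ea: (x o0 0) => a; move Eb: (x o1 0) => b; move Ec: (x o2 0) => c.
move=> E2 E1 E0.
set M : K[i] := m.+3%:R in E0 E1 E2.
have M_neq0 : M != 0 by exact: nz.
have b0 : b = 0.
  (* After the case split [M] is the original index, so the factor is (M - 2) M (M + 3) = - det
     A_M. *)
  have : (m.+1%:R * M * (m.+3 + 3)%:R) * b = 0.
    rewrite (_ : m.+1%:R = M - 2); last by rewrite -natrB.
    rewrite natrD -/M.
    (* (M + 1)(M E1 - 2i E2) + f (M - 2) E0 eliminates a and c, where f = 1/5
       and E0, E1, E2 are the three rows of the system. *)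
    transitivity (- ((M + 1) * (M * (f * a + (- M * b + -2 * 'i%C * c))
       - 2 * 'i%C * (- f * 'i%C * a + (2 * 'i%C * b + - M * c)))
       + f * (M - 2) * ((- M - 1) * a + 10 * b))
       (* [ring] treats [f] as an atom, so the elimination leaves 10 f where 2 is wanted; this term,
          zero by [f5], corrects that. *)
       - 2 * (M - 2) * b * (1 - f * 5)); last first.
      by rewrite E0 E1 E2 f5; ring.
    ring: i2.
  by move=> /eqP; rewrite !mulf_eq0 !(negPf (nz _)) => /eqP.
have a0 : a = 0.
  move: E0; rewrite b0 mulr0 addr0 -opprD mulNr => /eqP.
  by rewrite oppr_eq0 mulf_eq0 natr1 (negPf (nz _)) => /eqP.
have c0 : c = 0.
  move: E2; rewrite a0 b0 !mulr0 !add0r => /eqP.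
  by rewrite mulNr oppr_eq0 mulf_eq0 (negPf M_neq0) => /eqP.
apply/matrixP=> i j; rewrite !mxE ord1.
case: i => [[|[|[|//]]] lti].
- by rewrite -[RHS]a0 -Ea; congr (x _ _); apply/val_inj.
- by rewrite -[RHS]b0 -Eb; congr (x _ _); apply/val_inj.
- by rewrite -[RHS]c0 -Ec; congr (x _ _); apply/val_inj.
Qed.

(** Turns the bounds at indices up to m into the bound wanted at index m + 1, first for the forcing
    term, from which it passes to X_m. *)
Lemma size_vecF (K : realType) (P Q R : int -> {poly K[i]}) (m : nat) :
  (0 < m)%N ->
  (forall n : nat, (n <= m)%N ->
    [/\ (size (P n%:Z) <= (n.+1 %/ 2).+1)%N,
        (size (Q (n%:Z - 1)%R) <= (n.+1 %/ 2).+1)%N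
      & (size (R (n%:Z - 1)%R) <= (n.+1 %/ 2).+1)%N]) ->
  forall i, (size (vecF P Q R m i 0%R) <= (m.+2 %/ 2).+1)%N.
Proof.
move=> m_gt0 IH.
have szprod (S : int -> {poly K[i]}) :
    (forall n : nat, (n <= m)%N ->
      (size (S (n%:Z - 1)%R) <= (n.+1 %/ 2).+1)%N) ->
    (size (\sum_(j < m.+1) P j%:Z * S (m%:Z - j%:Z - 1))%R
       <= (m.+2 %/ 2).+1)%N.
  move=> szS; apply: leq_trans (size_sum _ _ _) _; apply/bigmax_leqP => j _.
  have jm : (j <= m)%N by rewrite -ltnS.
  have [szP _ _] := IH j jm.
  (* m - j - 1 is the shifted index belonging to n = m - j. As sizes are degrees plus one, the
     product has size at most the sum of the sizes minus one. *)
  have := szS (m - j)%N (leq_subr _ _); rewrite -subzn // => szSj.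
  apply: leq_trans (size_polyMleq _ _) _; lia.
have [szPm szQm szRm] := IH m (leqnn m).
have [szPm1 _ _] := IH m.-1 (leq_pred m).
(* This is where 0 < m enters: P_(m-1) must have a natural index to be covered by [IH]. *)
have m1E : m%:Z - 1 = m.-1%:Z by lia.
have mono n p : (n <= m)%N -> (p <= (n.+1 %/ 2).+1)%N -> (p <= (m.+2 %/ 2).+1)%N.
  by lia.
case=> [[|[|[|//]]] ?]; rewrite !mxE /=.
- by apply: size_scale_le; apply: mono szPm.
- apply: size_polyD_le; last by rewrite size_polyN; apply: szprod => n /IH[].
  apply: size_polyD_le; last by rewrite size_polyN; apply: mono szQm.
  by apply: size_scale_le; rewrite m1E; apply: mono szPm1; apply: leq_pred.
- apply: size_polyD_le; last by apply: szprod => n /IH[].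
  by apply: size_scale_le; apply: mono szRm.
Qed.

(** The recursion first produces X_3 = (P_4, Q_3, R_3), so n <= 3 is read off the explicit
    values. *)
Lemma size_expansion_init (K : realType) (D : K[i]) (P Q R : int -> {poly K[i]})
    (n : nat) :
  expansion D P Q R -> (n <= 3)%N ->
  [/\ (size (P n%:Z) <= (n.+1 %/ 2).+1)%N,
      (size (Q (n%:Z - 1)%R) <= (n.+1 %/ 2).+1)%N
    & (size (R (n%:Z - 1)%R) <= (n.+1 %/ 2).+1)%N].
Proof.
case=> _ _ _ Qm1 Rm1 P0 Q0 R0 P1 Q1 R1 P2 Q2 R2 P3 _.
have szC (c : K[i]) d : (size c%:P <= d.+1)%N.
  exact: leq_trans (size_polyC_leq1 c) _.
have szD (p q : {poly K[i]}) d :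
    (size p <= d)%N && (size q <= d)%N -> (size (p + q)%R <= d)%N.
  by case/andP; apply: size_polyD_le.
have szZX (c : K[i]) d : (size (c *: 'X)%R <= d.+2)%N.
  by apply: size_scale_le; rewrite size_polyX.
have szZX2 (c : K[i]) d : (size (c *: 'X^2)%R <= d.+3)%N.
  by apply: size_scale_le; rewrite size_polyXn.
case: n => [|[|[|[|//]]]] _.
- by rewrite P0 Qm1 Rm1; split; apply: szC.
- rewrite (_ : 1%:Z - 1 = 0) // P1 Q0 R0.
  by split; rewrite ?szD ?size_polyN ?szC ?szZX.
- rewrite (_ : 2%:Z - 1 = 1) // P2 Q1 R1.
  by split; rewrite ?szD ?size_polyN ?szC ?szZX.
- rewrite (_ : 3%:Z - 1 = 2) // P3 Q2 R2.
  by split; rewrite !szD ?size_polyN ?szC ?szZX ?szZX2.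
Qed.

(** The shift groups the entries of X_(n-1). The range starts at n = 0 because the j = m terms of
    the sums in F_m contain Q_(-1) and R_(-1); the induction is strong because these sums reach back
    to all earlier indices. *)
Lemma size_expansion (K : realType) (D : K[i]) (P Q R : int -> {poly K[i]})
    (n : nat) :
  expansion D P Q R ->
  [/\ (size (P n%:Z) <= (n.+1 %/ 2).+1)%N,
      (size (Q (n%:Z - 1)%R) <= (n.+1 %/ 2).+1)%N
    & (size (R (n%:Z - 1)%R) <= (n.+1 %/ 2).+1)%N].
Proof.
move=> hPQR; elim/ltn_ind: n => n IH.
have [n3|] := leqP n 3; first exact: size_expansion_init _ _ _ _ _ _ hPQR n3.
case: n IH => // m IH m3.
have szX := size_linear_ode_sol _ _ _ _ _ _
  (fun x => mulmx_matA_eq0 _ _ x m3)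
  (size_vecF _ _ _ _ _ (ltnW (ltnW m3)) IH) (exp_ode hPQR m3).
rewrite (_ : m.+1%:Z - 1 = m%:Z); last by lia.
rewrite (_ : m.+1%:Z = m%:Z + 1); last by lia.
by split; [have := szX 0 | have := szX 1 | have := szX 2%:R]; rewrite !mxE.
Qed.

Theorem lemma3p1 (K : realType) (D : K[i]) (P Q R : int -> {poly K[i]})
    (hPQR : expansion D P Q R) (m : nat) :
  [/\ (size (P (m%:Z + 1)%R) <= ((m + 2) %/ 2).+1)%N,
      (size (Q m%:Z) <= ((m + 2) %/ 2).+1)%N
    & (size (R m%:Z) <= ((m + 2) %/ 2).+1)%N].
Proof.
have := size_expansion _ _ _ _ _ m.+1 hPQR.
rewrite (_ : m.+1%:Z - 1 = m%:Z); last by lia.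
by rewrite (_ : m.+1%:Z = m%:Z + 1) ?addn2; last by lia.
Qed.
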